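(* Let $G$ be a data graph with $m$ edges, let $b\ge1$, and let $h$ be a hash function from the nodes of $G$ to buckets $\{1,\ldots,b\}$. Consider the one-round map-reduce triangle-finding algorithm with one reducer for each list $[i,j,k]$ with $1\le i\le j\le k\le b$, in which each edge $(u,v)$ of $G$ is sent to exactly the reducers whose list is the sorted list consisting of $h(u)$, $h(v)$ and any one bucket from $1$ to $b$, and in which each reducer outputs those triangles among its received edges for which the sorted list of the buckets of the three nodes is the reducer's list. Then the number of reducers is $\binom{b+2}{3}=(b+2)(b+1)b/6$; every triangle of $G$ is discovered by exactly one reducer; and every edge is sent to exactly $b$ reducers, so the communication cost is $mb$. Consequently, in terms of the number $k$ of reducers, the communication cost of this algorithm is asymptotically $m\sqrt[3]{6k}$ as $k\to\infty$, compared with asymptotically $\tfrac32 m\sqrt[3]{6k}$ for the Partition Algorithm using $k$ reducers, an improvement by a factor of $3/2$.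
   Context: The communication cost of a map-reduce algorithm is the number of (edge, reducer) pairs such that the edge is sent by the mappers to that reducer. The Partition Algorithm with $b$ sets partitions the nodes into $b$ disjoint subsets $S_1,\ldots,S_b$ of equal size, has one reducer for each triple $1\le i<j<k\le b$ (hence $\binom{b}{3}$ reducers), and sends to that reducer all edges both of whose nodes are in $S_i\cup S_j\cup S_k$. An edge with both ends in one set is thus sent to $\binom{b-1}{2}$ reducers and an edge with ends in two different sets is sent to $b-2$ reducers; taking an expected fraction $1/b$ of the edges to be of the first kind, its (expected) communication cost is $\tfrac32\,m\,(b-1)(b-2)/b$. *)

(* Defs.v *)
From mathcomp Require Import all_boot all_order all_algebra.

Set Implicit Arguments.
Unset Strict Implicit.
Unset Printing Implicit Defensive.

Import GRing.Theory Num.Theory.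

Record data_graph := DataGraph {
  node :> finType;
  adj : rel node;
  adj_sym : symmetric adj;
  adj_irrefl : irreflexive adj }.

(* Edges are unordered: an edge is the two-element set of its ends. *)
Definition edges (G : data_graph) : {set {set G}} :=
  [set E : {set G} | [exists u : G, exists v : G, adj u v && (E == [set u; v])]].

Definition num_edges (G : data_graph) : nat := #|edges G|.

(* A triangle is identified with the set of its three nodes. *)
Definition is_triangle (V : finType) (F : {set {set V}}) (T : {set V}) : bool :=
  (#|T| == 3) &&
  [forall u in T, forall v in T, (u != v) ==> ([set u; v] \in F)].

(* A one-round algorithm with reducer set K is given by the relation
   [sent E r]: "the mappers send the edge E to the reducer r". *)
Definition comm_cost (G : data_graph) (rT : finType) (K : {set rT})
    (sent : {set G} -> rT -> bool) : nat :=
  #|[set x : {set G} * rT | [&& x.1 \in edges G, x.2 \in K & sent x.1 x.2]]|.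

(* Buckets are numbered from 0 to b - 1 instead of from 1 to b. *)
Definition sort_buckets (b : nat) (s : seq 'I_b) : seq 'I_b :=
  sort (fun i j : 'I_b => i <= j) s.

Section OrderedBuckets.

Variables (G : data_graph) (b : nat) (h : G -> 'I_b).

Definition reducers : {set 3.-tuple 'I_b} :=
  [set r : 3.-tuple 'I_b | sorted (fun i j : 'I_b => i <= j) r].

Definition sent (E : {set G}) (r : 3.-tuple 'I_b) : bool :=
  [exists u : G, exists v : G, exists c : 'I_b,
     (E == [set u; v]) && (tval r == sort_buckets [:: h u; h v; c])].

Definition received (r : 3.-tuple 'I_b) : {set {set G}} :=
  [set E in edges G | sent E r].

Definition output (r : 3.-tuple 'I_b) : {set {set G}} :=
  [set T : {set G} | is_triangle (received r) T &&
     (sort_buckets [seq h x | x <- enum T] == tval r)].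

Definition cost : nat := comm_cost reducers sent.

End OrderedBuckets.

Section PartitionAlgorithm.

Variables (G : data_graph) (b : nat).

Definition part_reducers : {set 3.-tuple 'I_b} :=
  [set r : 3.-tuple 'I_b | sorted (fun i j : 'I_b => i < j) r].

(* A partition of the nodes is given by the map p sending a node to the index
   of its part, so S_i is the preimage of i. *)
Definition part_sent (p : {ffun G -> 'I_b}) (E : {set G})
    (r : 3.-tuple 'I_b) : bool :=
  [forall u in E, p u \in r].

Definition part_cost (p : {ffun G -> 'I_b}) : nat :=
  comm_cost part_reducers (part_sent p).

Definition inner_edges (p : {ffun G -> 'I_b}) : {set {set G}} :=
  [set E in edges G | [forall u in E, forall v in E, p u == p v]].

Local Open Scope ring_scope.

Variable R : realFieldType.

Definition is_distribution (P : {ffun G -> 'I_b} -> R) : Prop :=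
  (forall p, 0 <= P p) /\ \sum_p P p = 1.

Definition expectation (P : {ffun G -> 'I_b} -> R)
    (X : {ffun G -> 'I_b} -> R) : R :=
  \sum_p P p * X p.

(* A random partition for which an expected fraction 1/b of the edges have both
   ends in one part.  Equal part sizes matter to the cost only through this
   fraction, and are not required: the uniformly random p qualifies for
   every b >= 1, whereas for some graphs (complete ones with b >= 2, for
   instance) no partition into parts of exactly equal size gives exactly 1/b. *)
Definition random_partition (P : {ffun G -> 'I_b} -> R) : Prop :=
  is_distribution P /\
  expectation P (fun p => #|inner_edges p|%:R) = (num_edges G)%:R / b%:R.

Definition expected_part_cost (P : {ffun G -> 'I_b} -> R) : R :=
  expectation P (fun p => (part_cost p)%:R).

End PartitionAlgorithm.

Arguments reducers : clear implicits.
Arguments part_reducers : clear implicits.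

(* Main.v *)
Require Import Defs.
From mathcomp Require Import all_boot all_order all_algebra.

(** Once two of the three buckets are fixed to [h u] and [h v], the reducer's list
determines the remaining bucket, so an edge reaches one reducer per bucket; in
the Partition Algorithm the reducers of an edge are the 3-subsets of the parts
containing the one or two parts that it meets.  Writing [c] for the cube root of
[6k], the identities [6k = b(b+1)(b+2)] and [6k = b(b-1)(b-2)] give
[b <= c <= b+1] and [b-2 <= c <= b-1] respectively, so each cost is within a
constant multiple of [m] of the claimed main term, which has order [mc]. *)

(** * Sorted lists of three buckets *)

Lemma sort_bucketsP (b : nat) (s t : seq 'I_b) :
  reflect (sort_buckets s = sort_buckets t) (perm_eq s t).
Proof.
apply: perm_sortP => [i j|j i k|i j]; first exact: leq_total.
- exact: leq_trans.
- by move/anti_leq/val_inj.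
Qed.

Lemma sort_buckets_sorted (b : nat) (s : seq 'I_b) :
  sorted (fun i j : 'I_b => i <= j) (sort_buckets s).
Proof. by apply: sort_sorted => i j; apply: leq_total. Qed.

Definition bucket_list {b : nat} (i j c : 'I_b) : 3.-tuple 'I_b :=
  [tuple of sort (fun i j : 'I_b => i <= j) [:: i; j; c]].

Lemma val_bucket_list (b : nat) (i j c : 'I_b) :
  tval (bucket_list i j c) = sort_buckets [:: i; j; c].
Proof. by []. Qed.

Lemma bucket_list_reducer (b : nat) (i j c : 'I_b) :
  bucket_list i j c \in reducers b.
Proof. by rewrite inE val_bucket_list sort_buckets_sorted. Qed.

(** Sorting preserves the multiset, so the common entries [i] and [j] cancel, even when [c] or [d]
    repeats one of them. *)
Lemma bucket_list_inj (b : nat) (i j : 'I_b) : injective (bucket_list i j).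
Proof.
move=> c d /(congr1 val) /sort_bucketsP.
by rewrite !perm_cons => /perm_mem/(_ d); rewrite !inE eqxx => /eqP.
Qed.

Lemma bucket_list_perm (b : nat) (i j c i' j' c' : 'I_b) :
  perm_eq [:: i; j; c] [:: i'; j'; c'] ->
  bucket_list i j c = bucket_list i' j' c'.
Proof. by move=> /sort_bucketsP ijc; apply: val_inj. Qed.

(** * Numbers of reducers of the two algorithms *)

Lemma card_reducers (b : nat) : #|reducers b| = 'C(b + 2, 3).
Proof.
(* The count of weakly increasing tuples used below is over ['I_b.+1]; over ['I_0] there is no
   triple, and ['C(2, 3)] is 0. *)
case: b => [|b].
  by apply: eq_card0 => -[[|[] //]].
rewrite addn2 -[b.+3]/(3 + b)%N -card_sorted_tuples.
by apply: eq_card => t; rewrite !inE sorted_map.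
Qed.

Lemma card_part_reducers (b : nat) : #|part_reducers b| = 'C(b, 3).
Proof.
rewrite -card_ltn_sorted_tuples.
by apply: eq_card => t; rewrite !inE sorted_map.
Qed.

(** * Edges, triangles and cost with ordered buckets *)

(** Membership is used in both directions so that multiplicities agree as well: [u = v] forces
    [x = y]. *)
Lemma perm_map_set2 (T : finType) (S : eqType) (f : T -> S) (u v x y : T) :
  [set u; v] = [set x; y] -> perm_eq [:: f u; f v] [:: f x; f y].
Proof.
move=> eqE.
have := set21 u v; have := set22 u v; rewrite eqE => /set2P vxy /set2P uxy.
have := set21 x y; have := set22 x y; rewrite -eqE => /set2P yuv /set2P xuv.
have swap a c : perm_eq [:: a; c] [:: c; a].
  by apply/permPl; exact: (perm_catC [:: a] [:: c]).
by case: uxy => ?; case: vxy => ?; subst => //;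
   case: xuv => ?; case: yuv => ?; subst.
Qed.

(** [sent] quantifies over all ways to write the edge as a pair; they give the same two buckets up
    to order, so only the free bucket remains. *)
Lemma sent_set2 (G : data_graph) (b : nat) (h : G -> 'I_b) (u v : G)
    (r : 3.-tuple 'I_b) :
  sent h [set u; v] r = [exists c, r == bucket_list (h u) (h v) c].
Proof.
apply/existsP/existsP => [[x /existsP[y /existsP[c /andP[/eqP eqE rE]]]]|[c rE]].
  exists c; apply/eqP; have -> : r = bucket_list (h x) (h y) c.
    exact/val_inj/eqP.
  apply: bucket_list_perm.
  rewrite perm_sym (perm_cat2r [:: c] [:: h u; h v] [:: h x; h y]).
  exact: perm_map_set2.
by exists u; apply/existsP; exists v; apply/existsP; exists c; rewrite eqxx.
Qed.

Lemma edgesP (G : data_graph) (E : {set G}) :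
  reflect (exists u v, [/\ adj u v, u != v & E = [set u; v]])
    (E \in edges G).
Proof.
rewrite inE; apply: (iffP existsP).
  move=> [u /existsP[v /andP[uv /eqP->]]]; exists u, v; split=> //.
  by apply/eqP => uv0; rewrite uv0 adj_irrefl in uv.
by move=> [u [v [uv _ ->]]]; exists u; apply/existsP; exists v; rewrite uv eqxx.
Qed.

Lemma card_sent (G : data_graph) (b : nat) (h : G -> 'I_b) (E : {set G}) :
  E \in edges G -> #|[set r in reducers b | sent h E r]| = b.
Proof.
case/edgesP => u [v [_ _ ->]].
rewrite -[RHS]card_ord -(card_imset _ (@bucket_list_inj b (h u) (h v))).
apply: eq_card => r; rewrite inE sent_set2.
apply/andP/imsetP => [[_ /existsP[c /eqP->]]|[c _ ->]]; first by exists c.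
by rewrite bucket_list_reducer; split=> //; apply/existsP; exists c.
Qed.

Lemma comm_costE (G : data_graph) (rT : finType) (K : {set rT})
    (s : {set G} -> rT -> bool) :
  comm_cost K s = \sum_(E in edges G) #|[set r in K | s E r]|.
Proof.
rewrite /comm_cost -sum1dep_card -(pair_big_dep (mem (edges G))
  (fun E r => (r \in K) && s E r) (fun _ _ => 1)).
by apply: eq_bigr => E _; rewrite -sum1dep_card.
Qed.

Lemma costE (G : data_graph) (b : nat) (h : G -> 'I_b) :
  cost h = num_edges G * b.
Proof.
rewrite /cost comm_costE (eq_bigr (fun=> b)) ?sum_nat_const //.
by move=> E; exact: card_sent.
Qed.

(** Uniqueness is forced by [output], which prescribes the list of the triangle's buckets. That
    reducer does receive each of the three edges, through the bucket of the opposite node. *)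
Lemma triangle_unique_reducer (G : data_graph) (b : nat) (h : G -> 'I_b)
    (T : {set G}) : is_triangle (edges G) T ->
  exists! r : 3.-tuple 'I_b, r \in reducers b /\ T \in output h r.
Proof.
case/andP => /[dup] cardT /eqP cardT' /forall_inP triT.
move: cardT'; rewrite cardE; case enumT: (enum T) => [|x [|y [|z []]]] // _.
have memT w : (w \in T) = (w \in [:: x; y; z]) by rewrite -enumT mem_enum.
exists (bucket_list (h x) (h y) (h z)); split=> [|r [_]]; last first.
  by rewrite inE enumT => /andP[_ /eqP rE]; apply: val_inj; rewrite /= -[RHS]rE.
rewrite bucket_list_reducer inE enumT /= eqxx andbT /is_triangle cardT.
split=> //; apply/forall_inP => u uT; apply/forall_inP => v vT; apply/implyP => uv.
have uvG : [set u; v] \in edges G.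
  exact: implyP (forall_inP (triT u uT) v vT) uv.
rewrite /received in_set uvG sent_set2 /=.
(* the third bucket is that of the node of the triangle off the edge *)
suff [w uvw] : exists w, perm_eq [:: x; y; z] [:: u; v; w].
  apply/existsP; exists (h w); apply/eqP/bucket_list_perm.
  exact: (perm_map h uvw).
(* The witness [w] is what is left of the duplicate-free enumeration of [T] once [u] and [v] are
   removed. *)
have uTz : u \in [:: x; y; z] by rewrite -memT.
have vTz : v \in rem u [:: x; y; z].
  by rewrite mem_rem_uniq -?enumT ?enum_uniq // inE enumT -memT vT eq_sym uv.
have sz : size (rem v (rem u [:: x; y; z])) = 1 by rewrite !size_rem.
have := perm_to_rem vTz; move: (rem v _) sz => [|w []] // _ rE; exists w.
by apply: (perm_trans (perm_to_rem uTz)); rewrite perm_cons.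
Qed.

(** * Reducers per edge and cost in the Partition Algorithm *)

(* Increasing triples containing [A] are the [3 - #|A|]-subsets of [~: A]. *)
Lemma card_part_reducers_sub (b : nat) (A : {set 'I_b}) : (#|A| <= 3)%N ->
  #|[set r in part_reducers b | A \subset r]| = 'C(b - #|A|, 3 - #|A|).
Proof.
move=> A3.
have -> : (b - #|A| = #|~: A|)%N.
  by have := cardsC A; rewrite card_ord => /esym/(canLR (addKn _)).
rewrite -cards_draws.
pose D (r : 3.-tuple 'I_b) := ([set i in r] :\: A).
have rK (r : 3.-tuple 'I_b) : A \subset r -> (D r :|: A) = [set i in r].
  move=> /subsetP Ar; apply/setP => i; rewrite !inE.
  by case: (boolP (i \in A)) => [/Ar ->|_]; rewrite ?orbT ?orbF.
(* [D] is injective here: [D r] and [A] give back the set of entries of [r], and a strictly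
   increasing list is determined by its entries. *)
rewrite -(@card_in_imset _ _ D); last first.
  move=> r s; rewrite !inE => /andP[r_lt Ar] /andP[s_lt As] eqD.
  apply: val_inj; apply: (irr_sorted_eq (leT := fun i j : 'I_b => (i < j)%N)) => //.
  - by move=> j i k; exact: ltn_trans.
  - by move=> i; exact: ltnn.
  by move=> i; move/setP/(_ i): (rK r Ar); rewrite eqD rK // !inE.
apply: eq_card => B; rewrite inE; apply/imsetP/andP.
  move=> [r]; rewrite !inE => /andP[r_lt Ar] ->; split.
    by apply/subsetP => i; rewrite !inE => /andP[].
  rewrite cardsD (setIidPr _); last first.
    by apply/subsetP => i /(subsetP Ar); rewrite inE.
  rewrite cardsE (card_uniqP _) ?size_tuple //.
  apply: sorted_uniq r_lt => [j i k|i]; [exact: ltn_trans|exact: ltnn].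
(* The preimage of [B] is the enumeration of [B :|: A], which has three elements because [B] and [A]
   are disjoint. *)
move=> [BA /eqP cB].
have cBA : #|B :|: A| == 3.
  rewrite cardsU (_ : B :&: A = set0) ?cards0 ?subn0 ?cB ?subnK //.
  by apply/eqP; rewrite setI_eq0 disjoints_subset.
pose t := tcast (eqP cBA) (enum_tuple (B :|: A)).
have tE : t = enum (B :|: A) :> seq 'I_b by rewrite val_tcast.
have memt i : (i \in t) = (i \in B) || (i \in A) by rewrite memtE tE mem_enum inE.
exists t; last first.
  apply/setP => i; rewrite !inE memt.
  have [iA|_] := boolP (i \in A); last by rewrite orbF.
  by apply/negbTE/negP => /(subsetP BA); rewrite inE iA.
rewrite !inE; apply/andP; split; last first.
  by apply/subsetP => i iA; rewrite memt iA orbT.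
rewrite tE; suff: sorted ltn (map val (enum (B :|: A))) by rewrite sorted_map.
(* The enumeration of a set of ordinals is filtered out of that of ['I_b], whose values form an
   increasing [iota]. *)
rewrite -[enum _](eq_filter (mem_enum _)).
rewrite -(eq_filter (mem_map val_inj _)) -filter_map.
by rewrite (sorted_filter ltn_trans) // unlock val_ord_enum iota_ltn_sorted.
Qed.

Lemma inner_edges_sub (G : data_graph) (b : nat) (p : {ffun G -> 'I_b}) :
  inner_edges p \subset edges G.
Proof. by apply/subsetP => E; rewrite inE => /andP[]. Qed.

(** The receiving triples are those containing [[set p u; p v]], which has one element for an inner
    edge and two otherwise. *)
Lemma card_part_sent (G : data_graph) (b : nat) (p : {ffun G -> 'I_b})
    (E : {set G}) : E \in edges G ->
  #|[set r in part_reducers b | part_sent p E r]| =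
  if E \in inner_edges p then 'C(b - 1, 2) else b - 2.
Proof.
move=> EG; have [u [v [_ uv EE]]] := edgesP _ _ EG.
have -> : (E \in inner_edges p) = (p u == p v).
  rewrite inE EG /=; apply/idP/idP.
    move/forall_inP/(_ u); rewrite EE set21 => /(_ isT)/forall_inP/(_ v).
    by rewrite set22 => ->.
  move=> /eqP puv; apply/forall_inP => x; rewrite EE => /set2P xE.
  by apply/forall_inP => y /set2P yE; case: xE => ->; case: yE => ->; rewrite ?puv.
have -> : [set r in part_reducers b | part_sent p E r] =
          [set r in part_reducers b | [set p u; p v] \subset r].
  apply/setP => r; rewrite !inE; congr andb; rewrite /part_sent EE.
  apply/forall_inP/subsetP => [pE _ /set2P[]->|pE _ /set2P[]->].
  - by apply: pE; rewrite set21.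
  - by apply: pE; rewrite set22.
  - by apply: pE; rewrite set21.
  - by apply: pE; rewrite set22.
rewrite card_part_reducers_sub ?cards2; first by case: eqP; rewrite ?bin1.
by case: eqP.
Qed.

Lemma part_costE (G : data_graph) (b : nat) (p : {ffun G -> 'I_b}) :
  part_cost p = #|inner_edges p| * 'C(b - 1, 2)
                + (num_edges G - #|inner_edges p|) * (b - 2).
Proof.
rewrite /part_cost comm_costE (eq_bigr _ (fun E => @card_part_sent G b p E)).
rewrite (bigID (fun E => E \in inner_edges p)) /=; congr addn.
  rewrite (eq_bigr (fun=> 'C(b - 1, 2))) => [|E /andP[_ ->] //].
  rewrite sum_nat_const; congr muln; apply: eq_card => E.
  exact/andb_idl/(subsetP (inner_edges_sub G b p)).
rewrite (eq_bigr (fun=> b - 2)) => [|E /andP[_ /negbTE->] //].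
rewrite sum_nat_const; congr muln.
rewrite /num_edges -(cardsID (inner_edges p) (edges G)).
rewrite (setIidPr (inner_edges_sub G b p)) addKn; apply: eq_card => E.
by rewrite in_setD andbC.
Qed.

(* Costs compared with the cube root of six times the number of reducers *)
From mathcomp Require Import ring lra.
From mathcomp Require Import all_classical all_reals all_analysis.
Import GRing.Theory Num.Theory Order.TTheory.
Import numFieldNormedType.Exports.
Local Open Scope classical_set_scope.
Local Open Scope ring_scope.

Lemma natr_card_reducers (R : numDomainType) (b : nat) :
  (6 * #|reducers b|)%:R = b%:R * (b%:R + 1) * (b%:R + 2) :> R.
Proof.
rewrite card_reducers mulnC -[6%N]/(3`!) bin_ffact !ffactnS ffactn0 muln1.
by rewrite addn2 /= !natrM -[b.+2]addn2 -[b.+1]addn1 !natrD; ring.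
Qed.

Lemma natr_card_part_reducers (R : numDomainType) (b : nat) : (2 <= b)%N ->
  (6 * #|part_reducers b|)%:R = b%:R * (b%:R - 1) * (b%:R - 2) :> R.
Proof.
move=> b2; rewrite card_part_reducers mulnC -[6%N]/(3`!) bin_ffact !ffactnS.
rewrite ffactn0 muln1 -subn1 -subn1 -subnDA !natrM !natrB //; last exact: ltnW.
by rewrite mulrA.
Qed.

(** The cost is affine in the number of inner edges, so its expectation depends on [P] only through
    the expected number of these. *)
Lemma expected_part_costE (R : realFieldType) (G : data_graph) (b : nat)
    (P : {ffun G -> 'I_b} -> R) : (2 <= b)%N -> random_partition P ->
  expected_part_cost P =
  3 / 2 * (num_edges G)%:R * ((b%:R - 1) * (b%:R - 2) / b%:R).
Proof.
move=> b2 [[_ P1] Pinner]; rewrite /expected_part_cost /Defs.expectation.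
set m := num_edges G.
have b0 : b%:R != 0 :> R by rewrite pnatr_eq0 -lt0n (leq_trans _ b2).
have bin2E : ('C(b - 1, 2))%:R = (b%:R - 1) * (b%:R - 2) / 2 :> R.
  have -> : (b%:R - 1) * (b%:R - 2) = ('C(b - 1, 2) * 2`!)%:R :> R.
    rewrite bin_ffact !ffactnS ffactn0 muln1 -subn1 -subnDA natrM !natrB //.
    exact: ltnW.
  by rewrite natrM mulfK // pnatr_eq0.
have costpE (p : {ffun G -> 'I_b}) : (part_cost p)%:R =
    #|inner_edges p|%:R * ((b%:R - 1) * (b%:R - 2) / 2 - (b%:R - 2))
    + m%:R * (b%:R - 2) :> R.
  rewrite part_costE natrD !natrM natrB; last first.
    exact: subset_leq_card (inner_edges_sub G b p).
  by rewrite bin2E (natrB _ b2) -/m; ring.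
under eq_bigr do rewrite costpE mulrDr !mulrA.
rewrite big_split /= -!mulr_suml.
move: Pinner; rewrite /Defs.expectation => ->; rewrite P1 -/m.
by field.
Qed.

Lemma powR_cube_root (R : realType) (x : R) :
  0 <= x -> (x `^ 3%:R^-1) ^+ 3 = x.
Proof.
by move=> x0; rewrite -powR_mulrn ?powR_ge0 // -powRrM mulVf ?powRr1.
Qed.

(** Compare cubes: b(b+1)(b+2) = (b+1)^3 - (b+1), which is at least b^3. *)
Lemma reducers_cube_root (R : realType) (b : nat) :
  b%:R <= (6 * #|reducers b|)%:R `^ (3%:R^-1 : R) <= b%:R + 1.
Proof.
set x := (6 * _)%:R; have x0 : 0 <= x by exact: ler0n.
have b0 : 0 <= b%:R :> R by exact: ler0n.
have c0 := powR_ge0 x 3%:R^-1.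
apply/andP; split; rewrite -(ler_pXn2r (n := 3)) ?nnegrE ?addr_ge0 //;
  by rewrite powR_cube_root // /x natr_card_reducers; nra.
Qed.

(** Here b(b-1)(b-2) = (b-1)^3 - (b-1); [2 <= b] makes both bounds nonnegative, so that cubes can be
    compared. *)
Lemma part_reducers_cube_root (R : realType) (b : nat) : (2 <= b)%N ->
  b%:R - 2 <= (6 * #|part_reducers b|)%:R `^ (3%:R^-1 : R) <= b%:R - 1.
Proof.
move=> b2; set x := (6 * _)%:R; have x0 : 0 <= x by exact: ler0n.
have b0 : 2 <= b%:R :> R by rewrite (ler_nat R 2).
have c0 := powR_ge0 x 3%:R^-1.
apply/andP; split; rewrite -(ler_pXn2r (n := 3)) ?nnegrE ?subr_ge0 //;
  rewrite ?powR_cube_root // /x ?natr_card_part_reducers //; nra.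
Qed.

Lemma dist_cost_le (R : realType) (G : data_graph) (b : nat) (h : G -> 'I_b) :
  `|(cost h)%:R - (num_edges G)%:R * (6 * #|reducers b|)%:R `^ 3%:R^-1|
    <= (num_edges G)%:R :> R.
Proof.
rewrite costE natrM -mulrBr normrM ger0_norm // ler_piMr //.
by have /andP[] := reducers_cube_root R b; rewrite ler_norml => ? ?; lra.
Qed.

Lemma dist_expected_part_cost_le (R : realType) (G : data_graph) (b : nat)
    (P : {ffun G -> 'I_b} -> R) : (2 <= b)%N -> random_partition P ->
  `|expected_part_cost P
    - 3 / 2 * (num_edges G)%:R * (6 * #|part_reducers b|)%:R `^ 3%:R^-1|
    <= 3 * (num_edges G)%:R.
Proof.
move=> b2 rP; rewrite expected_part_costE // -mulrBr normrM.
have b0 : 2 <= b%:R :> R by rewrite (ler_nat R 2).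
rewrite ger0_norm ?mulr_ge0 //.
have /andP[] := part_reducers_cube_root R b b2; set c := _ `^ _ => c1 c2.
(* The quotient lies in [b-3, b-2] and [c] in [b-2, b-1], so they differ by at most 2; the factor
   3/2 turns this into the constant 3. *)
have qE : (b%:R - 1) * (b%:R - 2) / b%:R = b%:R - 3 + 2 / b%:R :> R.
  by field; apply: lt0r_neq0; lra.
have q0 : 0 <= 2 / b%:R :> R by rewrite divr_ge0.
have q1 : 2 / b%:R <= 1 :> R by rewrite ler_pdivrMr ?mul1r //; lra.
have : `|(b%:R - 1) * (b%:R - 2) / b%:R - c| <= 2 by rewrite qE ler_norml; lra.
have : 0 <= (num_edges G)%:R :> R by exact: ler0n.
nra.
Qed.

Lemma cvg_cube_root (R : realType) (k : nat -> nat) : k @ \oo --> \oo ->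
  (fun n => (6 * k n)%:R `^ 3%:R^-1 : R) @ \oo --> +oo.
Proof.
move=> koo; apply/cvgryPge => A.
(* A nonnegative bound is needed to compare cubes. *)
pose B := Num.max A 0.
have B0 : 0 <= B by rewrite le_max lexx orbT.
have /cvgnyPge/(_ (Num.truncn (B ^+ 3)).+1) := koo; apply: filterS => n kn.
apply: (@le_trans _ _ B); first by rewrite le_max lexx.
rewrite -(ler_pXn2r (n := 3)) ?nnegrE ?powR_ge0 // powR_cube_root //.
apply: (@le_trans _ _ (k n)%:R); last by rewrite ler_nat leq_pmull.
apply: (@le_trans _ _ (Num.truncn (B ^+ 3)).+1%:R); last by rewrite ler_nat.
exact/ltW/truncnS_gt.
Qed.

(** * From error bounds to asymptotic equivalence *)

(** Once [c n] exceeds K/e, the error [K * m n] is at most e times [m n * c n], hence at most e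
    times [g n]. The scale [m] may vary with [n] and vanish, so nothing is divided by it. *)
Lemma equiv_of_dist_le (R : realType) (f g m c : nat -> R) (K : R) :
  0 <= K -> (forall n, 0 <= m n) -> c @ \oo --> +oo ->
  (\forall n \near \oo, m n * c n <= g n) ->
  (\forall n \near \oo, `|f n - g n| <= K * m n) ->
  (f : nat -> R^o) ~_\oo (g : nat -> R^o).
Proof.
move=> K0 m0 /cvgryPge coo mcg fg; apply/eqaddoP => e e0.
near=> n; rewrite -[(f - g) n]/(f n - g n).
apply: le_trans (_ : K * m n <= _); first by near: n.
have gn : m n * c n <= g n by near: n.
apply: le_trans (_ : e * g n <= _); last by rewrite ler_wpM2l ?ler_norm // ltW.
apply: le_trans (_ : e * (m n * c n) <= _); last by rewrite ler_wpM2l // ltW.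
rewrite [leRHS]mulrCA [leLHS]mulrC ler_wpM2l // mulrC -ler_pdivrMr //.
by near: n; exact: coo.
Unshelve. all: by end_near.
Qed.

Theorem mainTheorem6 (R : realType) :
  (* the algorithm on a data graph G, with b buckets and hash function h *)
  (forall (G : data_graph) (b : nat) (h : G -> 'I_b), (1 <= b)%N ->
     [/\ #|reducers b| = 'C(b + 2, 3),
         ('C(b + 2, 3))%:R = ((b + 2) * (b + 1) * b)%:R / 6%:R :> R,
         (forall T : {set G}, is_triangle (edges G) T ->
            exists! r : 3.-tuple 'I_b, r \in reducers b /\ T \in output h r),
         (forall E : {set G}, E \in edges G ->
            #|[set r in reducers b | sent h E r]%SET| = b) &
         cost h = (num_edges G * b)%N])
  /\
  (* asymptotics along arbitrary runs in which the number k of reducers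
     tends to infinity *)
  (forall (G : nat -> data_graph) (k : nat -> nat), k @ \oo --> \oo ->
     [/\ (forall (b : nat -> nat) (h : forall n, G n -> 'I_(b n)),
            (forall n, #|reducers (b n)| = k n) ->
            (fun n => (cost (h n))%:R : R^o) ~_\oo
            (fun n => (num_edges (G n))%:R * (6 * k n)%:R `^ (3%:R^-1) : R^o)),
         (forall (b : nat -> nat) (P : forall n, {ffun G n -> 'I_(b n)} -> R),
            (forall n, #|part_reducers (b n)| = k n) ->
            (forall n, random_partition (P n)) ->
            (fun n => expected_part_cost (P n) : R^o) ~_\oo
            (fun n => 3%:R / 2%:R * (num_edges (G n))%:R
                      * (6 * k n)%:R `^ (3%:R^-1) : R^o)) &
         (forall (b b' : nat -> nat) (h : forall n, G n -> 'I_(b n))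
                 (P : forall n, {ffun G n -> 'I_(b' n)} -> R),
            (forall n, #|reducers (b n)| = k n) ->
            (forall n, #|part_reducers (b' n)| = k n) ->
            (forall n, random_partition (P n)) ->
            (forall n, (0 < num_edges (G n))%N) ->
            (fun n => expected_part_cost (P n) / (cost (h n))%:R : R^o) @ \oo
              --> (3%:R / 2%:R : R^o))]).
Proof.
split=> [G b h b1|G k koo].
  split; [exact: card_reducers| |exact: triangle_unique_reducer
         |exact: card_sent|exact: costE].
  rewrite -card_reducers; apply: (mulIf (x := 6%:R)); first by rewrite pnatr_eq0.
  rewrite divfK ?pnatr_eq0 // mulrC -natrM natr_card_reducers.
  by rewrite !natrM !natrD; ring.
have coo := cvg_cube_root R k koo.
(* Eventually [k n] is positive, so ['C(b' n, 3)] is nonzero and [b' n] is at least 3. *)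
have b2 (b' : nat -> nat) : (forall n, #|part_reducers (b' n)| = k n) ->
    \forall n \near \oo, (2 <= b' n)%N.
  move=> kE; have /cvgnyPge/(_ 1) := koo; apply: filterS => n.
  by rewrite -kE card_part_reducers bin_gt0; exact: ltnW.
split=> [b h kE|b P kE rP|b b' h P kE kE' rP m0].
- apply: (equiv_of_dist_le R _ _ (fun n => (num_edges (G n))%:R) _ 1 _ _ coo) => //.
    exact: nearW.
  by apply: nearW => n; rewrite mul1r -kE dist_cost_le.
- apply: (equiv_of_dist_le R _ _ (fun n => (num_edges (G n))%:R) _ 3 _ _ coo) => //.
    apply: nearW => n; rewrite -mulrA ler_peMl ?mulr_ge0 ?powR_ge0 //; lra.
  have := b2 b kE; apply: filterS => n bn2.
  by rewrite -kE dist_expected_part_cost_le.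
apply/cvgrPdist_le => e e0.
(* With c the cube root, x is within 3m of (3/2)mc and the other cost mb is within m of mc, so x is
   within 3m + (3/2)m = (9/2)m of (3/2)mb. Dividing by mb leaves 9/(2b), which is at most e because
   b >= c - 1. *)
have /cvgryPge/(_ (9 / 2 / e + 1)) := coo => coo'.
near=> n.
have cn : 9 / 2 / e + 1 <= (6 * k n)%:R `^ 3%:R^-1 by near: n.
have bn2 : (2 <= b' n)%N by near: n; exact: b2.
have := dist_expected_part_cost_le R _ _ _ bn2 (rP n).
rewrite kE' ler_norml => /andP[].
have := dist_cost_le R _ _ (h n); rewrite kE ler_norml => /andP[].
have /andP[_] := reducers_cube_root R (b n); rewrite kE.
set c := _ `^ _ in cn *; rewrite costE natrM.
set x := expected_part_cost _; set m := (num_edges (G n))%:R; set bb := (b n)%:R.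
have m_gt0 : 0 < m :> R by rewrite ltr0n.
move=> cb y1 y2 x1 x2.
have eb : 9 / 2 <= e * bb by rewrite -ler_pdivrMl // [e^-1 * _]mulrC; lra.
have bb0 : 0 < bb by rewrite -(pmulr_rgt0 _ e0); lra.
have -> : 3 / 2 - x / (m * bb) = (3 / 2 * (m * bb) - x) / (m * bb).
  by field; rewrite !gt_eqF.
rewrite normrM normfV (gtr0_norm (mulr_gt0 m_gt0 bb0)) ler_pdivrMr ?mulr_gt0 //.
have meb : m * (9 / 2) <= m * (e * bb) by rewrite ler_wpM2l // ltW.
by rewrite ler_norml; lra.
Unshelve. all: by end_near.
Qed.
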